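(* Let $d\geq 1$, let $f:[0,1]^d\to\mathbb{R}$ be a continuous function, and let $\Delta\subset[0,1]^d$ be a polytope of dimension $d$. There exists $D_0>0$ (possibly depending on $d$, $\Delta$ and $f$) such that for every finite sequence $(x_1,\ldots,x_n)$ in $[0,1)^d$ with discrepancy $D=D(x_1,\ldots,x_n)\leq D_0$ and every real $M$ with $|f(x)|\leq M$ for all $x\in[0,1)^d$, \begin{multline*} \left|\frac{1}{n}\sum_{\substack{i=1 \\ x_i\in\Delta}}^nf(x_i)-\int_{\Delta} f\,d\mu\right|\leq (1+2^{d+1})\rho(f,D^{1/(d+1)})+M\Big( \frac{(1+2^{d+1})D^{1/(2d+2)}}{\mathrm{inrad}(\Delta)}\\ +(4d\sqrt d+1)D^{1/d}e(\Delta)+\frac{2\,\mathrm{diam}(\Delta)S(\Delta)D^{1/(2d+2)}}{\sqrt{d}} \Big). \end{multline*}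
   Context: $\mu$ is Lebesgue measure and $|\cdot|$ the maximum norm. The discrepancy of $(x_1,\ldots,x_n)$ in $[0,1)^d$ is $D(x_1,\ldots,x_n)=\sup_B\left|\frac{1}{n}\#\{i:x_i\in B\}-\mu(B)\right|$, $B$ ranging over boxes $\prod_{i=1}^d[a_i,b_i)$ with $0\leq a_i<b_i\leq1$. The modulus of continuity is $\rho(f,t)=\sup\{|f(x)-f(y)|:x,y\in[0,1]^d,\ |x-y|\leq t\}$. $\mathrm{inrad}(\Delta)$ is the radius of a cubic (maximum-norm) ball of maximal radius contained in $\Delta$; $\mathrm{diam}(\Delta)=\max\{|x-y|:x,y\in\Delta\}$; $e(\Delta)$ is the number of facets (codimension-one faces) of $\Delta$; for a facet $F$ with Euclidean unit normal $v_F$, $\mathrm{vol}(F)=\mu(\{u+\lambda v_F:u\in F,0\leq\lambda\leq1\})$, and the surface area $S(\Delta)$ is the sum of the volumes of all facets. *)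

(* Defs.v *)
From HB Require Import structures.
From mathcomp Require Import all_boot all_order all_algebra finmap.
From mathcomp Require Import all_classical all_reals all_analysis.

Set Implicit Arguments.
Unset Strict Implicit.
Unset Printing Implicit Defensive.

Import Order.TTheory GRing.Theory Num.Theory.
Import numFieldTopology.Exports numFieldNormedType.Exports.

Local Open Scope classical_set_scope.
Local Open Scope ring_scope.

(** The sigma-algebra on row vectors is the one generated by the coordinates,
    as for [n.-tuple T] in the library; over the reals it is the Borel one. *)

Definition measure_rV_display : measure_display -> measure_display.
Proof. exact. Qed.

Section measurable_rV.
Context {d : measure_display} {T : measurableType d} (n : nat).

Let coors : 'I_n -> 'rV[T]_n -> T := fun i x => x ord0 i.

Let rV_set0 : g_sigma_preimage coors set0.
Proof. exact: sigma_algebra0. Qed.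

Let rV_setC A : g_sigma_preimage coors A -> g_sigma_preimage coors (~` A).
Proof. exact: sigma_algebraC. Qed.

Let rV_bigcup (F : (set 'rV[T]_n)^nat) : (forall i, g_sigma_preimage coors (F i)) ->
  g_sigma_preimage coors (\bigcup_i (F i)).
Proof. exact: sigma_algebra_bigcup. Qed.

HB.instance Definition _ := @isMeasurable.Build (measure_rV_display d)
  'rV[T]_n (g_sigma_preimage coors) rV_set0 rV_setC rV_bigcup.

End measurable_rV.

Lemma measurable_coord_rV d (T : measurableType d) n (i : 'I_n) :
  measurable_fun [set: 'rV[T]_n] (fun x : 'rV[T]_n => x ord0 i).
Proof.
move=> _ Y mY; rewrite setTI; apply: sub_sigma_algebra => /=.
rewrite -bigcup_seq/=; exists i => /=; first by rewrite mem_index_enum.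
by exists Y => //; rewrite setTI.
Qed.

Lemma measurable_fun_rVP d1 d2 (T1 : measurableType d1)
    (T2 : measurableType d2) n (f : T1 -> 'rV[T2]_n) :
  (forall i, measurable_fun [set: T1] (fun x => f x ord0 i)) ->
  measurable_fun [set: T1] f.
Proof.
move=> mf _ Y mY; rewrite setTI.
suff : <<s \big[setU/set0]_(i < n) preimage_set_system setT
   (fun x : 'rV[T2]_n => x ord0 i) measurable >> `<=` [set A | measurable (f @^-1` A)].
  by apply.
apply: smallest_sub.
  split => /= [|A mA|F mF].
  - by rewrite preimage_set0.
  - by rewrite setTD -preimage_setC; exact: measurableC.
  - by rewrite preimage_bigcup; exact: bigcupT_measurable.
move=> A; rewrite -bigcup_seq => -[i _ [B mB <-]] /=.
by have := mf i measurableT B mB; rewrite !setTI.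
Qed.

Section lebesgue_measure_rV.
Context {R : realType}.

Definition cons_rV n (p : R * 'rV[R]_n) : 'rV[R]_n.+1 :=
  \row_i oapp (p.2 ord0) p.1 (unlift ord0 i).

Definition uncons_rV n (x : 'rV[R]_n.+1) : R * 'rV[R]_n :=
  (x ord0 ord0, \row_j x ord0 (lift ord0 j)).

Lemma cons_rVK n : cancel (@cons_rV n) (@uncons_rV n).
Proof.
move=> [a x]; rewrite /uncons_rV !mxE unlift_none /=; congr (_, _).
by apply/rowP => j; rewrite !mxE liftK.
Qed.

Lemma uncons_rVK n : cancel (@uncons_rV n) (@cons_rV n).
Proof.
move=> x; apply/rowP => i; rewrite mxE.
by case: unliftP => [j|] -> //=; rewrite mxE.
Qed.

Lemma measurable_cons_rV n : measurable_fun [set: R * 'rV[R]_n] (@cons_rV n).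
Proof.
apply: measurable_fun_rVP => i.
rewrite (_ : (fun _ => _) =
    fun p : R * 'rV[R]_n => oapp (p.2 ord0) p.1 (unlift ord0 i)); last first.
  by apply/funext => p; rewrite mxE.
case: (unlift ord0 i) => [j|] /=; last exact: measurable_fst.
by apply: (measurableT_comp (measurable_coord_rV j)); exact: measurable_snd.
Qed.

Lemma measurable_uncons_rV n :
  measurable_fun [set: 'rV[R]_n.+1] (@uncons_rV n).
Proof.
apply/measurable_fun_pairP; split => /=; first exact: measurable_coord_rV.
apply: measurable_fun_rVP => i.
rewrite (_ : (fun _ => _) = fun x : 'rV[R]_n.+1 => x ord0 (lift ord0 i)).
  exact: measurable_coord_rV.
by apply/funext => x /=; rewrite mxE.
Qed.

Section step.
Variables (n : nat) (m : {sigma_finite_measure set 'rV[R]_n -> \bar R}).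

Definition lebesgue_cons : set 'rV[R]_n.+1 -> \bar R :=
  pushforward (@lebesgue_measure R \x m)%E (@cons_rV n).

Let lebesgue_cons0 : lebesgue_cons set0 = 0%E.
Proof. by rewrite /lebesgue_cons /pushforward preimage_set0 measure0. Qed.

Let lebesgue_cons_ge0 A : (0 <= lebesgue_cons A)%E.
Proof. exact: (@measure_ge0 _ _ _ (@lebesgue_measure R \x m)%E). Qed.

Let lebesgue_cons_sigma_additive : semi_sigma_additive lebesgue_cons.
Proof.
move=> F mF tF mUF; rewrite /lebesgue_cons /pushforward preimage_bigcup.
have mpre A : measurable A -> measurable (@cons_rV n @^-1` A).
  by move=> mA; rewrite -[X in measurable X]setTI; exact: measurable_cons_rV.
apply: (@measure_semi_sigma_additive _ _ _ (@lebesgue_measure R \x m)%E).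
- by move=> k; exact: mpre.
- apply/trivIsetP => /= i j _ _ ij; rewrite -preimage_setI.
  by move/trivIsetP : tF => /(_ _ _ _ _ ij) ->//; rewrite preimage_set0.
- by rewrite -preimage_bigcup; exact: mpre.
Qed.

HB.instance Definition _ := isMeasure.Build _ _ _ lebesgue_cons
  lebesgue_cons0 lebesgue_cons_ge0 lebesgue_cons_sigma_additive.

Let lebesgue_cons_sigma_finite : sigma_finite setT lebesgue_cons.
Proof.
have /sigma_finiteP[F [TF ndF Foo]] := sigma_finiteT (@lebesgue_measure R).
have /sigma_finiteP[G [TG ndG Goo]] := sigma_finiteT m.
exists (fun k => @uncons_rV n @^-1` (F k `*` G k)).
  rewrite -preimage_bigcup -(preimage_setT (@uncons_rV n)); congr (_ @^-1` _).
  rewrite -setXTT TF TG predeqE => -[x y]; split.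
    move=> [/= [k _ Fkx] [l _ Gly]]; exists (maxn k l) => //; split.
    - by move: x Fkx; exact/subsetPset/ndF/leq_maxl.
    - by move: y Gly; exact/subsetPset/ndG/leq_maxr.
  by move=> [k _ []/= ? ?]; split; exists k.
move=> k; have [? ?] := Foo k; have [? ?] := Goo k; split.
  rewrite -[X in measurable X]setTI.
  by apply: measurable_uncons_rV => //; exact: measurableX.
rewrite /lebesgue_cons /pushforward -comp_preimage.
rewrite (_ : @uncons_rV n \o @cons_rV n = id); last first.
  by apply/funext => p /=; rewrite cons_rVK.
rewrite preimage_id product_measure1E// lte_mul_pinfty//.
by rewrite ge0_fin_numE.
Qed.

HB.instance Definition _ := @Measure_isSigmaFinite.Build _ _ _ lebesgue_cons
  lebesgue_cons_sigma_finite.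

End step.

(** Lebesgue measure on [R^n], restricted to the Borel sets: the [n]-fold
    product of the one-dimensional Lebesgue measure, the first coordinate
    being split off at each step. *)
Fixpoint lebesgue_rV (n : nat) : {sigma_finite_measure set 'rV[R]_n -> \bar R} :=
  match n with
  | 0 => [the {sigma_finite_measure set 'rV[R]_0 -> \bar R} of \d_(0 : 'rV[R]_0)]
  | k.+1 => [the {sigma_finite_measure set 'rV[R]_k.+1 -> \bar R}
              of lebesgue_cons (lebesgue_rV k)]
  end.

Definition box n (a b : 'rV[R]_n) : set 'rV[R]_n :=
  [set x | forall i, a ord0 i <= x ord0 i < b ord0 i].

Lemma measurable_box n (a b : 'rV[R]_n) : measurable (box a b).
Proof.
rewrite (_ : box a b = \bigcap_(i in [set: 'I_n])
    ((fun x : 'rV[R]_n => x ord0 i) @^-1` `[a ord0 i, b ord0 i[)).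
  apply: fin_bigcap_measurable => // i _.
  by rewrite -[X in measurable X]setTI; exact: measurable_coord_rV.
apply/seteqP; split => x /= abx i => [_|]; rewrite ?in_itv/=; first exact: abx.
by have := abx i Logic.I; rewrite /= in_itv.
Qed.

Lemma lebesgue_rV_box n (a b : 'rV[R]_n) :
  (forall i, a ord0 i <= b ord0 i) ->
  lebesgue_rV n (box a b) = (\prod_(i < n) (b ord0 i - a ord0 i))%:E.
Proof.
elim: n a b => [|n IHn] a b ab.
  rewrite big_ord0 /= diracE mem_set// => -[]//.
rewrite big_ord_recl /=.
pose a1 : 'rV[R]_n := \row_j a ord0 (lift ord0 j).
pose b1 : 'rV[R]_n := \row_j b ord0 (lift ord0 j).
have ab1 i : a1 ord0 i <= b1 ord0 i by rewrite !mxE.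
have consE : @cons_rV n @^-1` box a b =
    `[a ord0 ord0, b ord0 ord0[%classic `*` box a1 b1.
  apply/seteqP; split => -[x y] /=.
    move=> H; split => [|i].
      by have := H ord0; rewrite in_itv/= mxE unlift_none.
    by have := H (lift ord0 i); rewrite !mxE liftK.
  move=> [/=]; rewrite in_itv/= => Hx Hy i; rewrite mxE.
  case: unliftP => [j|] -> //=.
  by have := Hy j; rewrite !mxE.
have mb1 : measurable (box a1 b1) by exact: measurable_box.
rewrite /lebesgue_cons /pushforward consE product_measure1E//=.
have prodE : \prod_(i < n) (b1 ord0 i - a1 ord0 i) =
    \prod_(i < n) (b ord0 (lift ord0 i) - a ord0 (lift ord0 i)).
  by apply: eq_bigr => i _; rewrite !mxE.
rewrite lebesgue_measure_itv/= lte_fin (IHn a1 b1 ab1) prodE EFinM.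
case: ltP => // ba; have -> : b ord0 ord0 = a ord0 ord0.
  by apply/eqP; rewrite eq_le ba ab.
by rewrite subrr mul0e.
Qed.

End lebesgue_measure_rV.

Section polytopes.
Context {R : realType} {d : nat}.
Implicit Types (A F : set 'rV[R]_d) (x v : 'rV[R]_d).

Definition polytope A := exists (m : nat) (p : 'I_m -> 'rV[R]_d),
  A = [set x | exists w : 'I_m -> R,
    [/\ forall i, 0 <= w i, \sum_i w i = 1 & x = \sum_i w i *: p i]].

(** [A] has (affine) dimension [k]: the points [x0] and [x0 + row i B] are
    affinely independent points of [A] whose affine hull contains [A]. *)
Definition has_dim A (k : nat) := exists (x0 : 'rV[R]_d) (B : 'M[R]_(k, d)),
  [/\ A x0, row_free B, forall i, A (x0 + row i B) &
      forall x, A x -> (x - x0 <= B)%MS].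

Definition dotp (u v : 'rV[R]_d) : R := \sum_i u ord0 i * v ord0 i.

(** Faces are cut out by the valid inequalities of [A]; taking [c = 0] gives
    the improper faces [A] and [set0], neither of dimension [d.-1] when [A] has
    dimension [d > 0]. *)
Definition face A F := exists (c : 'rV[R]_d) (t : R),
  (forall x, A x -> dotp c x <= t) /\ F = A `&` [set x | dotp c x = t].

Definition facets A : set (set 'rV[R]_d) :=
  [set F | face A F /\ has_dim F d.-1].

(** A polytope has finitely many facets; on an infinite set of facets
    [num_facets] and [surface_area] below would be 0 by convention. *)
Definition num_facets A : nat := #|` fset_set (facets A)|.

Definition unit_normal F v :=
  dotp v v = 1 /\ forall x y, F x -> F y -> dotp v (x - y) = 0.

(** The two unit normals of a facet give prisms that are translates of one
    another, so it does not matter which one is chosen. *)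
Definition facet_vol F : R :=
  let v := xget 0 (unit_normal F) in
  fine (lebesgue_rV d [set y | exists u l,
    [/\ F u, 0 <= l <= 1 & y = u + l *: v]]).

Definition surface_area A : R := \sum_(F \in facets A) facet_vol F.

(** On ['rV[R]_d] the norm [`|_|] is the maximum norm. The suprema defining
    [diam] and [inrad] are maxima for nonempty compact sets. *)
Definition diam A : R := sup [set r | exists x y, [/\ A x, A y & r = `|x - y|]].

Definition inrad A : R :=
  sup [set r | 0 <= r /\ exists x, closed_ball_ Num.norm x r `<=` A].

End polytopes.

Section discrepancy.
Context {R : realType} {d : nat}.

Definition cube : set 'rV[R]_d := [set x | forall i, 0 <= x ord0 i <= 1].

Definition half_open_cube : set 'rV[R]_d :=
  [set x | forall i, 0 <= x ord0 i < 1].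

Definition discrepancy n (x : 'I_n -> 'rV[R]_d) : R :=
  sup [set r | exists a b : 'rV[R]_d,
    (forall i, 0 <= a ord0 i /\ a ord0 i < b ord0 i /\ b ord0 i <= 1) /\
    r = `| n%:R^-1 * #|[pred i | x i \in box a b]|%:R
           - fine (lebesgue_rV d (box a b)) | ].

Definition modulus_of_continuity (f : 'rV[R]_d -> R) (t : R) : R :=
  sup [set r | exists x y, [/\ cube x, cube y, `|x - y| <= t
                             & r = `|f x - f y| ] ].

End discrepancy.

Arguments cube {R} d.
Arguments half_open_cube {R} d.

(* Main.v *)
Require Import Defs.
From HB Require Import structures.
From mathcomp Require Import all_boot all_order all_algebra finmap.
From mathcomp Require Import all_classical all_reals all_analysis.
From mathcomp Require Import measurable_realfun.
From mathcomp Require Import ring lra.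

Set Implicit Arguments.
Unset Strict Implicit.
Unset Printing Implicit Defensive.

Import Order.TTheory GRing.Theory Num.Theory.
Import numFieldTopology.Exports numFieldNormedType.Exports.

Local Open Scope classical_set_scope.
Local Open Scope ring_scope.

(** Cut [0,1)^d into N^d half-open cubes of side h = 1/N, with h just below
    D^(1/(d+1)).  On a cube contained in Delta, replacing f by its value at a
    corner costs rho(f, h) times the proportion of points plus the volume, and
    the discrepancy of the cube costs M D; cubes missing Delta contribute
    nothing, and a cube meeting the boundary costs at most M (D + 2 h^d).  The
    boundary cubes are controlled by dilations: if Delta is convex and contains
    a ball of radius r around x0, they all lie in the dilation of Delta about x0
    by 1 + h/r and avoid the one by 1 - h/r, so their total volume is O(h/r).
    Altogether the error is at most 2 rho(f, D^(1/(d+1))) + M O(D^(1/(d+1))),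
    and for small D the last term is absorbed by
    M (1 + 2^(d+1)) D^(1/(2d+2)) / inrad(Delta) alone; the two remaining terms
    of the right-hand side are only needed to be nonnegative. *)

(** * Homotheties *)

(** Uniqueness of Lebesgue measure: as a function of [A] the left side is a scaled pushforward
    measure, and it gives each interval []u, v]] its length. *)
Lemma lebesgue_measure_affine (R : realType) (c a : R) (A : set R) :
  0 < c -> measurable A ->
  (c%:E * @lebesgue_measure R [set x | A (c * x + a)%R])%E = lebesgue_measure A.
Proof.
move=> c0 mA; pose g (x : measurableTypeR R) : measurableTypeR R := c * x + a.
have mg : measurable_fun setT g.
  by apply: measurable_funD => //; apply: measurable_funM.
(* The measure structure of [pushforward] depends on the measurability proof
   [mg], which unification cannot guess. *)
pose m := mscale (NngNum (ltW c0))
  (measure_function_pushforward__canonical__measure_function_Measure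
    (@lebesgue_measure R) mg).
rewrite [RHS](@lebesgue_measure_unique _ m) //.
move=> _ /ocitvP[|[[u v] /= uv]] ->; first by rewrite !measure0.
rewrite /m /mscale /= /pushforward lebesgue_measure_itv /= lte_fin uv.
have -> : g @^-1` `]u, v]%classic = `](u - a) / c, (v - a) / c]%classic.
  apply/seteqP; split => x /=; rewrite !in_itv /= /g;
    by rewrite ltr_pdivrMr // ler_pdivlMr // ltrBlDr lerBrDr [x * c]mulrC.
rewrite lebesgue_measure_itv /= lte_fin ltr_pM2r ?invr_gt0 // ltrD2r uv.
by rewrite -!EFinB -EFinM; congr (_%:E); field; rewrite gt_eqF.
Qed.

(** Induction splitting off the first coordinate: on the product space the scaled pushforward agrees
    with the product measure on rectangles, hence everywhere. *)
Lemma lebesgue_rV_homothety (R : realType) (n : nat) (c : R) (a : 'rV[R]_n)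
    (A : set 'rV[R]_n) : 0 < c -> measurable A ->
  ((c ^+ n)%:E * lebesgue_rV n [set x | A (c *: x + a)%R])%E = lebesgue_rV n A.
Proof.
move=> c0; elim: n a A => [|n IHn] a A mA.
  rewrite expr0 mul1e /= !diracE (_ : [set x | _] = A) //.
  by apply/seteqP; split => x /=; have -> : c *: x + a = x by apply/rowP => -[].
have cn0 : 0 < c ^+ n.+1 by rewrite exprn_gt0.
pose a0 := a ord0 ord0; pose a1 : 'rV[R]_n := \row_j a ord0 (lift ord0 j).
pose g (p : measurableTypeR R * 'rV[R]_n) : measurableTypeR R * 'rV[R]_n :=
  (c * p.1 + a0, c *: p.2 + a1).
have mg : measurable_fun setT g.
  apply/measurable_fun_pairP; split => /=.
    by apply: measurable_funD => //; apply: measurable_funM.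
  apply: (@measurable_fun_rVP _ _ _ (measurableTypeR R)) => i.
  under eq_fun do rewrite !mxE.
  apply: measurable_funD => //; apply: measurable_funM => //.
  by apply: (measurableT_comp (measurable_coord_rV i)); exact: measurable_snd.
have [m mdef] : exists m : {measure set (measurableTypeR R * 'rV[R]_n) -> \bar R},
    forall X, m X = ((c ^+ n.+1)%:E *
      (@lebesgue_measure R \x lebesgue_rV n) (g @^-1` X))%E.
  by exists (mscale (NngNum (ltW cn0))
    (measure_function_pushforward__canonical__measure_function_Measure
      (@lebesgue_measure R \x lebesgue_rV n)%E mg)).
have mE B C : measurable B -> measurable C ->
    m (B `*` C) = (lebesgue_measure B * lebesgue_rV n C)%E.
  move=> mB mC; rewrite mdef.
  rewrite (_ : g @^-1` _ = [set x | B (c * x + a0)] `*`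
    [set x | C (c *: x + a1)]) //.
  rewrite product_measure1E.
  - by rewrite exprS EFinM muleACA lebesgue_measure_affine // IHn.
  - rewrite -[X in measurable X]setTI.
    have : measurable_fun setT (fun x : measurableTypeR R => c * x + a0).
      by apply: measurable_funD => //; apply: measurable_funM.
    exact.
  - rewrite -[X in measurable X]setTI.
    have : measurable_fun setT (fun x : 'rV[R]_n => c *: x + a1).
      apply: measurable_fun_rVP => i; under eq_fun do rewrite !mxE.
      apply: measurable_funD => //; apply: measurable_funM => //.
      exact: measurable_coord_rV.
    exact.
have mcA : measurable (@cons_rV R n @^-1` A).
  by rewrite -[X in measurable X]setTI; exact: measurable_cons_rV.
have consE p : c *: cons_rV p + a = cons_rV (g p).
  apply/rowP => i; rewrite !mxE.
  by case: unliftP => [j|] -> //=; rewrite !mxE.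
have preE : @cons_rV R n @^-1` [set x | A (c *: x + a)] =
    g @^-1` (@cons_rV R n @^-1` A).
  by apply/seteqP; split => p /=; rewrite consE.
rewrite /= /lebesgue_cons /pushforward preE (product_measure_unique mE mcA).
by rewrite mdef.
Qed.

(** * Measurability of open sets *)

Lemma rV_norm_le (R : realDomainType) (n : nat) (x : 'rV[R]_n) (e : R) :
  0 <= e -> (`|x| <= e) <-> (forall i, `|x ord0 i| <= e).
Proof.
move=> e0; rewrite /Num.norm /= mx_normrE; split.
  move=> /bigmax_leP[_ H] i; exact: (H (ord0, i)).
move=> H; apply/bigmax_leP; split => // -[i j] _ /=.
by rewrite (ord1 i); exact: H.
Qed.

Section measurability.
Context {R : realType}.

(** The sigma-algebra is generated by the coordinates, so open sets have to be reduced to boxes: [A]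
    is the union of the countably many rational grid boxes that it contains. *)
Lemma open_measurable_rV n (A : set 'rV[R]_n) : open A -> measurable A.
Proof.
move=> oA.
pose b (p : nat * 'rV[int]_n) : set 'rV[R]_n :=
  box (\row_i ((p.2 ord0 i)%:~R / p.1.+1%:R))
      (\row_i ((p.2 ord0 i + 1)%:~R / p.1.+1%:R)).
pose F p := if `[< b p `<=` A >] then b p else set0.
have -> : A = \bigcup_p F p.
  apply/seteqP; split => [x Ax|x [p _]]; last first.
    by rewrite /F; case: asboolP => // bA /bA.
  have /nbhs_ballP[e /= e0 xeA] : nbhs x A by exact: open_nbhs_nbhs.
  have e20 : 0 < e / 2 by rewrite divr_gt0.
  (* With mesh [1/(k+1) < e/2], the grid box around [x] stays in the open ball of radius [e];
     halving makes the non-strict bound of [rV_norm_le] strict. *)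
  pose k := Num.truncn (e / 2)^-1.
  have ke : k.+1%:R^-1 < e / 2.
    rewrite -[ltRHS]invrK ltf_pV2 ?posrE ?invr_gt0 ?ltr0n //.
    by have /andP[] := truncn_itv (ltW (etrans (invr_gt0 (e / 2)) e20)).
  have k0 : 0 < k.+1%:R :> R by rewrite ltr0n.
  pose z : 'rV[int]_n := \row_i Num.floor (x ord0 i * k.+1%:R).
  have bx : b (k, z) x.
    move=> i; rewrite !mxE /= ler_pdivrMr // ltr_pdivlMr //.
    exact: floor_itv.
  exists (k, z) => //; rewrite /F; case: asboolP => // -[] y by_.
  apply: xeA; rewrite mx_norm_ball /ball_ /=.
  apply: (@le_lt_trans _ _ (e / 2)); last by rewrite ltr_pdivrMr // ltr_pMr // ltr1n.
  apply/rV_norm_le; first exact: ltW.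
  move=> i; have := bx i; have := by_ i; rewrite !mxE /= intrD mulr1z mulrDl mul1r.
  move: (k.+1%:R^-1) ke => w wlt; move: (_ * w) => u /andP[? ?] /andP[? ?].
  rewrite ler_norml; apply/andP; split; lra.
apply: countable_bigcupT_measurable => [|p]; first exact: countableP.
rewrite /F; case: asboolP => _ //; exact: measurable_box.
Qed.

Lemma closed_measurable_rV n (A : set 'rV[R]_n) : closed A -> measurable A.
Proof.
by move/closed_openC/open_measurable_rV/measurableC; rewrite setCK.
Qed.

Lemma within_continuous_measurable_rV n (D : set 'rV[R]_n) (f : 'rV[R]_n -> R) :
  measurable D -> {within D, continuous f} -> measurable_fun D f.
Proof.
move=> mD /continuousP cf; apply: (measurability _ (RGenOpens.measurableE R)).
move=> _ [_ [a [b ->] <-]].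
have /open_subspaceP[V oV VD] := cf _ (@interval_open R (BRight a) (BLeft b) isT isT).
rewrite setIC -VD; apply: measurableI => //; exact: open_measurable_rV.
Qed.

End measurability.

(** * Polytopes *)

Section convex_sets.
Context {R : realType} {d : nat}.
Implicit Types (A : set 'rV[R]_d) (x y : 'rV[R]_d).

Lemma sum_continuous (T : topologicalType) (V : normedModType R) (m : nat)
    (F : 'I_m -> T -> V) :
  (forall i, continuous (F i)) -> continuous (fun z => \sum_i F i z).
Proof. by move=> cF; apply: continuous_big => //; exact: add_continuous. Qed.

Lemma itv_rV_compact (n : nat) (a b : R) :
  compact [set v : 'rV[R]_n | forall i, v ord0 i \in `[a, b]].
Proof.
apply: (@rV_compact _ _ (fun=> `[a, b]%classic)) => _; exact: segment_compact.
Qed.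

Lemma cube_compact : compact (cube d : set 'rV[R]_d).
Proof.
rewrite (_ : cube d = [set v : 'rV[R]_d | forall i, v ord0 i \in `[0, 1]]).
  exact: itv_rV_compact.
by apply/seteqP; split => v H i; have := H i; rewrite /= in_itv.
Qed.

(** A polytope is the continuous image of the simplex of weights, a closed part of a compact
    cube. *)
Lemma polytope_compact A : polytope A -> compact A.
Proof.
move=> [m [p ->]].
pose S := [set w : 'rV[R]_m | forall i, w ord0 i \in `[0, 1]] `&`
  (fun w : 'rV[R]_m => \sum_i w ord0 i) @^-1` [set 1].
have cS : compact S.
  apply: compact_closedI.
    exact: itv_rV_compact.
  apply: (@closed_comp _ _ (fun w : 'rV[R]_m => \sum_i w ord0 i) [set 1]);
    last exact: closed_eq.
  by move=> w _; apply: sum_continuous => i; exact: coord_continuous.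
rewrite (_ : [set _ | _] = (fun w : 'rV[R]_m => \sum_i w ord0 i *: p i) @` S).
  apply: continuous_compact => //; apply: continuous_subspaceT.
  apply: sum_continuous => i w.
  apply: (@continuous_comp _ _ _ (fun w : 'rV[R]_m => w ord0 i) ( *:%R^~ (p i))).
    exact: coord_continuous.
  exact: scalel_continuous.
apply/seteqP; split => [x [w [w0 w1 ->]]|x [w [w01 w1] <-]].
  exists (\row_i w i); last by apply: eq_bigr => i _; rewrite mxE.
  split => [i|/=]; last by rewrite -w1; apply: eq_bigr => i _; rewrite mxE.
  rewrite /= mxE in_itv /= w0 /= -w1 (bigD1 i) //= lerDl.
  by apply: sumr_ge0 => j _.
exists (fun i => w ord0 i); split => // i.
by have := w01 i; rewrite /= in_itv /= => /andP[].
Qed.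

Lemma polytope_closed A : polytope A -> closed A.
Proof. by move=> /polytope_compact; apply: compact_closed; exact: norm_hausdorff. Qed.

Lemma polytope_convex A x y (t : R) : polytope A -> A x -> A y -> 0 <= t <= 1 ->
  A (t *: x + (1 - t) *: y).
Proof.
move=> [m [p ->]] [u [u0 u1 ->]] [v [v0 v1 ->]] /andP[t0 t1].
exists (fun i => t * u i + (1 - t) * v i); split.
- by move=> i; rewrite addr_ge0 // mulr_ge0 // subr_ge0.
- by rewrite big_split /= -!mulr_sumr u1 v1; ring.
- rewrite !scaler_sumr -big_split /=; apply: eq_bigr => i _.
  by rewrite [RHS]scalerDl !scalerA.
Qed.

Lemma polytope_sum A (m : nat) (w : 'I_m -> R) (q : 'I_m -> 'rV[R]_d) :
  polytope A -> (forall i, A (q i)) -> (forall i, 0 <= w i) -> \sum_i w i = 1 ->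
  A (\sum_i w i *: q i).
Proof.
move=> [n [p ->]] /choice[u uP] w0 w1.
exists (fun k => \sum_i w i * u i k); split.
- by move=> k; apply: sumr_ge0 => i _; rewrite mulr_ge0 //; have [] := uP i.
- rewrite exchange_big /= -w1; apply: eq_bigr => i _.
  by rewrite -mulr_sumr; have [_ -> _] := uP i; rewrite mulr1.
- under eq_bigr => i _ do (have [_ _ ->] := uP i; rewrite scaler_sumr).
  rewrite exchange_big /=; apply: eq_bigr => k _.
  by rewrite scaler_suml; apply: eq_bigr => i _; rewrite scalerA.
Qed.

(** [A] contains the simplex on [x0] and the points [x0 + row i B]. Barycentric coordinates are
    affine in the point and all equal [1/(d+1)] at the barycentre [c], so they stay nonnegative
    nearby. *)
Lemma polytope_inball A : polytope A -> has_dim A d ->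
  exists x0 r, 0 < r /\ closed_ball_ Num.norm x0 r `<=` A.
Proof.
move=> pA [x0 [B [Ax0 /[!row_free_unit] uB AB _]]].
(* [K] dominates every column sum of absolute values in [invmx B], so a move of norm [e / K] changes
   each coordinate by at most [e]. *)
pose K : R := 1 + \sum_i \sum_j `|invmx B i j|.
have K0 : 0 < K.
  by rewrite ltr_wpDr //; do 2 (apply: sumr_ge0 => ? _).
(* This gives both [1/(d+1) - e >= 0] and [d (1/(d+1) + e) <= 1]; the latter leaves a nonnegative
   weight for [x0]. *)
pose e : R := (d.+1 * d.+1)%:R^-1.
have e0 : 0 < e by rewrite invr_gt0 ltr0n.
pose c := x0 + \sum_i d.+1%:R^-1 *: row i B.
exists c, (e / K); split; first exact: divr_gt0.
move=> y; rewrite /closed_ball_ /= distrC => /rV_norm_le yc.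
pose v : 'rV[R]_d := (y - c) *m invmx B.
have ve i : `|v ord0 i| <= e.
  rewrite mxE; apply: (le_trans (ler_norm_sum _ _ _)).
  apply: (@le_trans _ _ (\sum_j e / K * `|invmx B j i|)).
    apply: ler_sum => j _; rewrite normrM ler_wpM2r //; apply: yc.
    exact/ltW/divr_gt0.
  rewrite -mulr_sumr -mulrA ler_piMr ?(ltW e0) // mulrC ler_pdivrMr // mul1r.
  rewrite ler_wpDl // ler_sum // => j _; rewrite (bigD1 i) //= lerDl.
  exact: sumr_ge0.
pose w (i : 'I_d.+1) : R :=
  if unlift ord0 i is Some j then d.+1%:R^-1 + v ord0 j
  else 1 - \sum_j (d.+1%:R^-1 + v ord0 j).
pose q (i : 'I_d.+1) : 'rV[R]_d :=
  if unlift ord0 i is Some j then x0 + row j B else x0.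
pose s := \sum_j (d.+1%:R^-1 + v ord0 j).
have w0E : w ord0 = 1 - s by rewrite /w unlift_none.
have wSE j : w (lift ord0 j) = d.+1%:R^-1 + v ord0 j by rewrite /w liftK.
have q0E : q ord0 = x0 by rewrite /q unlift_none.
have qSE j : q (lift ord0 j) = x0 + row j B by rewrite /q liftK.
have d0 : 0 < d.+1%:R :> R by rewrite ltr0n.
have eE : d.+1%:R * e = d.+1%:R^-1.
  by rewrite /e natrM invfM mulrA divff ?mul1r // gt_eqF.
have -> : y = \sum_i w i *: q i.
  rewrite big_ord_recl w0E q0E.
  under eq_bigr => i _ do rewrite wSE qSE scalerDr.
  rewrite big_split /= -scaler_suml -/s addrA scalerBl scale1r subrK.
  under eq_bigr => i _ do rewrite scalerDl.
  rewrite big_split /= addrA -/c.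
  have -> : \sum_i v ord0 i *: row i B = v *m B by rewrite mulmx_sum_row.
  by rewrite /v mulmxKV // addrC subrK.
apply: polytope_sum => //.
- by move=> i; rewrite /q; case: unlift.
- move=> i; rewrite /w; case: unliftP => [j _|_].
    have := ve j; rewrite ler_norml => /andP[H _].
    have : e <= d.+1%:R^-1 by rewrite -eE ler_peMl ?ler1n // ltW.
    by move: H; move: (d.+1%:R^-1) => u ? ?; lra.
  rewrite subr_ge0 (@le_trans _ _ (\sum_(j < d) (d.+1%:R^-1 + e))) //.
    apply: ler_sum => j _; rewrite lerD2l.
    by apply: le_trans (ve j); exact: ler_norm.
  rewrite sumr_const card_ord -[X in X <= _]mulr_natl mulrDr.
  have -> : d%:R = d.+1%:R - 1 :> R by rewrite -natr1 addrK.
  rewrite !mulrBl divff ?gt_eqF // eE !mul1r.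
  by rewrite addrA subrK lerBlDr lerDl ltW.
- rewrite big_ord_recl w0E; under eq_bigr => i _ do rewrite wSE.
  by rewrite -/s subrK.
Qed.

End convex_sets.

(** * Grid cells *)

Section grid.
Context {R : realType} {d : nat} (k : nat).
Implicit Types (j : {ffun 'I_d -> 'I_k.+1}) (x y : 'rV[R]_d).

Definition grid_cell j : set 'rV[R]_d :=
  box (\row_i ((j i)%:R / k.+1%:R)) (\row_i ((j i).+1%:R / k.+1%:R)).

(** Meaningful on the half-open cube, where the truncation is at most [k] and [inord] does not fall
    back to its default. *)
Definition grid_index x : {ffun 'I_d -> 'I_k.+1} :=
  [ffun i => inord (Num.truncn (x ord0 i * k.+1%:R))].

Let k0 : 0 < k.+1%:R :> R. Proof. by rewrite ltr0n. Qed.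

Lemma measurable_grid_cell j : measurable (grid_cell j).
Proof. exact: measurable_box. Qed.

Lemma grid_cell_half_open_cube j : grid_cell j `<=` half_open_cube d.
Proof.
move=> x jx i; have /andP[] := jx i; rewrite !mxE => H1 H2.
rewrite (le_trans _ H1) ?divr_ge0 ?ler0n //= (lt_le_trans H2) //.
by rewrite ler_pdivrMr // mul1r ler_nat ltn_ord.
Qed.

Lemma grid_cellP x j : half_open_cube d x -> grid_cell j x <-> grid_index x = j.
Proof.
move=> x01; split => [jx|<- i].
  apply/ffunP => i; rewrite ffunE; have := jx i; rewrite !mxE.
  rewrite ler_pdivrMr // ltr_pdivlMr // => /truncn_def ->; exact: inord_val.
have /andP[x0 x1] := x01 i.
have xk0 : 0 <= x ord0 i * k.+1%:R by rewrite mulr_ge0.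
rewrite !mxE ler_pdivrMr // ltr_pdivlMr // ffunE.
have H := truncn_itv xk0; rewrite inordK //.
rewrite -(ltr_nat R); have /andP[H1 _] := H; apply: (le_lt_trans H1).
by rewrite gtr_pMl.
Qed.

Lemma trivIset_grid_cell (D : set {ffun 'I_d -> 'I_k.+1}) : trivIset D grid_cell.
Proof.
move=> i j _ _ [x [ix jx]]; have hx := grid_cell_half_open_cube ix.
by move/(grid_cellP _ hx): ix => <-; move/(grid_cellP _ hx): jx.
Qed.

Lemma grid_cell_dist j x y : grid_cell j x -> grid_cell j y ->
  `|x - y| <= k.+1%:R^-1.
Proof.
move=> jx jy; apply/rV_norm_le; first by rewrite invr_ge0 ler0n.
move=> i; have := jx i; have := jy i; rewrite !mxE -[(j i).+1%:R]natr1 mulrDl mul1r.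
move: (k.+1%:R^-1) => h; move: ((j i)%:R * h) => u /andP[? ?] /andP[? ?].
rewrite ler_norml; apply/andP; split; lra.
Qed.

Lemma lebesgue_grid_cell j :
  lebesgue_rV d (grid_cell j) = (k.+1%:R ^- d)%:E.
Proof.
rewrite lebesgue_rV_box => [|i]; last first.
  by rewrite !mxE ler_pM2r ?invr_gt0 // ler_nat.
congr (_%:E); under eq_bigr => i _ do
  rewrite !mxE -mulrBl -[(j i).+1%:R]natr1 addrAC subrr add0r mul1r.
by rewrite prodr_const card_ord exprVn.
Qed.

Lemma card_grid : #|{ffun 'I_d -> 'I_k.+1}| = (k.+1 ^ d)%N.
Proof. by rewrite card_ffun !card_ord. Qed.

Lemma bigcup_grid_cell : half_open_cube d = \bigcup_j grid_cell j.
Proof.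
apply/seteqP; split => [x hx|x [j _]]; last exact: grid_cell_half_open_cube.
by exists (grid_index x) => //; apply/grid_cellP.
Qed.

Lemma integral_grid (A : set 'rV[R]_d) (f : 'rV[R]_d -> R) :
  measurable A -> A `<=` half_open_cube d ->
  (lebesgue_rV d).-integrable A (EFin \o f) ->
  \int[lebesgue_rV d]_(x in A) f x =
  \sum_j \int[lebesgue_rV d]_(x in A `&` grid_cell j) f x.
Proof.
move=> mA Acube fi.
have mF j : measurable (A `&` grid_cell j).
  by apply: measurableI => //; exact: measurable_grid_cell.
have AE : A = \big[setU/set0]_(j <- index_enum {ffun 'I_d -> 'I_k.+1}) (A `&` grid_cell j).
  rewrite -big_distrr /= -bigcup_seq -[LHS](setIidl Acube) bigcup_grid_cell.
  congr (_ `&` _); apply/seteqP; split => [x [j _ jx]|x [j _ jx]]; exists j => //=.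
  exact: mem_index_enum.
rewrite /Rintegral [in LHS]AE integral_bigsetU_EFin //; first last.
- by rewrite -AE; case/integrableP: fi.
- by move=> i j _ _ [x [[_ ix] [_ jx]]]; apply: (@trivIset_grid_cell setT) => //; exists x.
- exact: index_enum_uniq.
rewrite sum_fine // => j _; apply: integrable_fin_num => //.
by apply: integrableS fi => //; exact: subIsetl.
Qed.

Lemma lebesgue_grid_cells (P : pred {ffun 'I_d -> 'I_k.+1}) :
  lebesgue_rV d (\bigcup_(j in [set` P]) grid_cell j) =
  (\sum_(j | P j) k.+1%:R ^- d)%:E.
Proof.
rewrite -sumEFin -big_filter.
set s := [seq _ <- _ | _]; have -> : [set` P] = [set` s].
  by apply/seteqP; split => j; rewrite /= mem_filter mem_index_enum andbT.
(* The volume of the disjoint union is computed as the integral of the constant 1. *)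
rewrite bigcup_seq -[LHS]mul1e -integral_cst; last first.
  by apply: bigsetU_measurable => j _; exact: measurable_grid_cell.
rewrite (@integral_bigsetU_EFin _ _ _ _ _ _ (cst 1)) //.
- apply: eq_bigr => j _.
  apply: (etrans (integral_cst (lebesgue_rV d) (measurable_grid_cell j) 1%E)).
  by rewrite mul1e; exact: lebesgue_grid_cell.
- by move=> j; exact: measurable_grid_cell.
- by rewrite filter_uniq // index_enum_uniq.
- exact: trivIset_grid_cell.
- by apply/measurable_EFinP; exact: measurable_cst.
Qed.

End grid.

(** * Dilations and boundary cells *)

Section dilation.
Context {R : realType} {d : nat}.
Variables (A : set 'rV[R]_d) (x0 : 'rV[R]_d) (r : R).
Hypothesis A_convex : forall x y (t : R), A x -> A y -> 0 <= t <= 1 ->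
  A (t *: x + (1 - t) *: y).
Hypothesis r0 : 0 < r.
Hypothesis ball_A : closed_ball_ Num.norm x0 r `<=` A.
Hypothesis mA : measurable A.
Hypothesis A_fin : (lebesgue_rV d A < +oo)%E.

(** For [t > 0], the image of [A] under the homothety of centre [x0] and ratio [t], written as a
    preimage so that [lebesgue_rV_homothety] applies directly. *)
Definition dilation (t : R) : set 'rV[R]_d :=
  [set x | A (t^-1 *: x + (1 - t^-1) *: x0)].

Let A0 : A x0.
Proof. by apply: ball_A; rewrite /closed_ball_ /= subrr normr0 ltW. Qed.

Let A_shift (u : 'rV[R]_d) (s : R) : 0 < s -> `|u| <= s * r -> A (x0 + s^-1 *: u).
Proof.
move=> s0 us; apply: ball_A; rewrite /closed_ball_ /= opprD addrA subrr sub0r normrN.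
rewrite normrZ gtr0_norm ?invr_gt0 // mulrC.
by rewrite ler_pdivrMr // mulrC.
Qed.

Lemma measurable_dilation t : measurable (dilation t).
Proof.
rewrite -[X in measurable X]setTI.
have : measurable_fun setT (fun x : 'rV[R]_d => t^-1 *: x + (1 - t^-1) *: x0).
  apply: measurable_fun_rVP => i; under eq_fun do rewrite !mxE.
  apply: measurable_funD => //; apply: measurable_funM => //.
  exact: measurable_coord_rV.
exact.
Qed.

Lemma lebesgue_dilation t : 0 < t ->
  lebesgue_rV d (dilation t) = (t ^+ d * fine (lebesgue_rV d A))%:E.
Proof.
move=> t0; have ti0 : 0 < t^-1 by rewrite invr_gt0.
rewrite EFinM fineK; last by rewrite ge0_fin_numE.
rewrite -(lebesgue_rV_homothety ((1 - t^-1) *: x0) ti0 mA) muleA -EFinM.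
by rewrite -exprMn divff ?gt_eqF // expr1n mul1e.
Qed.

(** The contraction of [z] by [1 + s] is a convex combination of [y] and the point
    [x0 + s^-1 *: (z - y)] of the ball. *)
Lemma sub_dilation (s : R) y z : 0 < s -> A y -> `|z - y| <= s * r ->
  dilation (1 + s) z.
Proof.
move=> s0 Ay zy; rewrite /dilation /=.
have s1 : 1 + s != 0 by rewrite gt_eqF // addr_gt0.
have -> : (1 + s)^-1 *: z + (1 - (1 + s)^-1) *: x0 =
    (1 + s)^-1 *: y + (1 - (1 + s)^-1) *: (x0 + s^-1 *: (z - y)).
  apply/rowP => i; rewrite !mxE; field.
  by rewrite s1 gt_eqF.
apply: A_convex => //; first exact: A_shift.
have s10 : 0 < 1 + s by rewrite addr_gt0.
by rewrite invr_ge0 (ltW s10) invf_le1 // lerDl ltW.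
Qed.

(** With weights [1 - s] and [s], the point [w] is a convex combination of the point of [A] whose
    dilation is [z] and of [x0 + s^-1 *: (w - z)] in the ball. *)
Lemma dilation_sub (s : R) w z : 0 < s < 1 -> dilation (1 - s) z ->
  `|w - z| <= s * r -> A w.
Proof.
move=> /andP[s0 s1]; rewrite /dilation /= => Az wz.
have s10 : 1 - s != 0 by rewrite subr_eq0 gt_eqF.
have -> : w = (1 - s) *: ((1 - s)^-1 *: z + (1 - (1 - s)^-1) *: x0) +
    (1 - (1 - s)) *: (x0 + s^-1 *: (w - z)).
  apply/rowP => i; rewrite !mxE; field.
  by rewrite s10 gt_eqF.
apply: A_convex => //; first exact: A_shift.
by rewrite subr_ge0 ltW //= lerBlDr lerDl ltW.
Qed.

(** Cells have diameter at most [s * r]. A cell meeting [dilation (1 - s)] would lie in [A], and a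
    cell meeting [A] lies in [dilation (1 + s)]; so the cells of [P] fit between the two dilations,
    whose volumes are compared. *)
Lemma boundary_cells (k : nat) (s : R) (P : pred {ffun 'I_d -> 'I_k.+1}) :
  0 < s < 1 -> k.+1%:R^-1 <= s * r ->
  (forall j, P j -> grid_cell j `&` A !=set0 /\ ~ (grid_cell j `<=` A)) ->
  \sum_(j | P j) k.+1%:R ^- d <=
    fine (lebesgue_rV d A) * ((1 + s) ^+ d - (1 - s) ^+ d).
Proof.
move=> /andP[s0 s1] hs PA.
pose U : set 'rV[R]_d := \bigcup_(j in [set` P]) grid_cell j.
have mU : measurable U.
  apply: fin_bigcup_measurable; first exact: finite_finset.
  by move=> j _; exact: measurable_grid_cell.
have UI : U `&` dilation (1 - s) = set0.
  rewrite -subset0 => z [[j Pj jz] dz]; have [_] := PA j Pj; apply.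
  move=> w jw; apply: (dilation_sub _ dz); first by rewrite s0.
  exact: le_trans (grid_cell_dist jw jz) hs.
have UD : U `|` dilation (1 - s) `<=` dilation (1 + s).
  move=> z [[j Pj jz]|dz].
    have [[y [jy Ay]] _] := PA j Pj.
    by apply: (sub_dilation s0 Ay); exact: le_trans (grid_cell_dist jz jy) hs.
  apply: (@sub_dilation _ z) => //; last first.
    by rewrite subrr normr0 mulr_ge0 // ltW.
  by apply: (dilation_sub _ dz); rewrite ?s0 // subrr normr0 mulr_ge0 // ltW.
have : (lebesgue_rV d U + lebesgue_rV d (dilation (1 - s)) <=
    lebesgue_rV d (dilation (1 + s)))%E.
  rewrite -measureU //; last exact: measurable_dilation.
  apply: le_measure; rewrite ?inE //; last exact: measurable_dilation.
  by apply: measurableU => //; exact: measurable_dilation.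
rewrite !lebesgue_dilation ?subr_gt0 ?addr_gt0 // /U lebesgue_grid_cells.
by rewrite -EFinD lee_fin -lerBrDr -mulrBl mulrC.
Qed.

End dilation.

(** * Discrepancy and modulus of continuity *)

Section discrepancy_bounds.
Context {R : realType} {d n : nat}.
Variable x : 'I_n -> 'rV[R]_d.
Hypothesis n0 : (0 < n)%N.

Let n0R : 0 < n%:R :> R. Proof. by rewrite ltr0n. Qed.

Lemma discrepancy_ge (a b : 'rV[R]_d) :
  (forall i, 0 <= a ord0 i /\ a ord0 i < b ord0 i /\ b ord0 i <= 1) ->
  `| n%:R^-1 * #|[pred i | x i \in box a b]|%:R - fine (lebesgue_rV d (box a b)) |
    <= discrepancy x.
Proof.
move=> ab; apply: ub_le_sup; last by exists a, b.
(* Proportion and volume both lie in [[0, 1]], so their difference is at most 1; without such a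
   bound [sup] would take its default value. *)
exists 1 => _ [u [v [uv ->]]].
rewrite lebesgue_rV_box /= => [|i]; last by have [_ [/ltW]] := uv i.
set p := \prod_(i < d) _; set c := #|_|%:R.
have p0 : 0 <= p.
  by apply: prodr_ge0 => i _; rewrite subr_ge0; have [_ [/ltW]] := uv i.
have p1 : p <= 1.
  apply: prodr_ile1 => i _; have [? [? ?]] := uv i.
  by rewrite subr_ge0 ltW //=; lra.
have c0 : 0 <= n%:R^-1 * c by rewrite mulr_ge0.
have c1 : n%:R^-1 * c <= 1.
  rewrite mulrC ler_pdivrMr // mul1r ler_nat.
  by apply: leq_trans (max_card _) _; rewrite card_ord.
move: (n%:R^-1 * c) c0 c1 => q ? ?.
by rewrite ler_norml; apply/andP; split; lra.
Qed.

Lemma discrepancy_grid_cell (k : nat) (j : {ffun 'I_d -> 'I_k.+1}) :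
  `| n%:R^-1 * #|[pred i | x i \in grid_cell j]|%:R - k.+1%:R ^- d |
    <= discrepancy x.
Proof.
have k0 : 0 < k.+1%:R :> R by rewrite ltr0n.
have -> : k.+1%:R ^- d = fine (lebesgue_rV d (grid_cell j : set 'rV[R]_d)).
  by rewrite lebesgue_grid_cell.
apply: discrepancy_ge => i; rewrite !mxE divr_ge0 // ltr_pM2r ?invr_gt0 //.
by rewrite ltr_nat ltnSn ler_pdivrMr // mul1r ler_nat ltn_ord.
Qed.

(* A grid cell of volume less than [1/n] around [x i] already contains a
   proportion [1/n] of the points. *)
Lemma discrepancy_gt0 : (0 < d)%N -> (forall i, half_open_cube d (x i)) ->
  0 < discrepancy x.
Proof.
move=> d0 x01; pose i0 := Ordinal n0; pose j := grid_index n (x i0).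
apply: lt_le_trans (discrepancy_grid_cell j).
rewrite normr_gt0 gt_eqF // subr_gt0.
have jx : grid_cell j (x i0) by apply/grid_cellP.
apply: (@lt_le_trans _ _ n%:R^-1).
  rewrite ltf_pV2 ?posrE ?exprn_gt0 ?ltr0n //.
  apply: (@lt_le_trans _ _ n.+1%:R); first by rewrite ltr_nat.
  by rewrite -natrX ler_nat -[leqLHS]expn1 leq_exp2l.
rewrite ler_peMr ?invr_ge0 // ler1n; apply/card_gt0P; exists i0.
by change (x i0 \in grid_cell j); exact: mem_set.
Qed.

End discrepancy_bounds.

Section modulus.
Context {R : realType} {d : nat}.
Variable f : 'rV[R]_d -> R.
Hypothesis f_cont : {within cube d, continuous f}.

Lemma continuous_cube_bounded : exists M : R, forall y, cube d y -> `|f y| <= M.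
Proof.
have /compact_bounded[M [_ HM]] := continuous_compact f_cont cube_compact.
exists (M + 1) => y yc; apply: HM; first by rewrite ltrDl.
by exists y.
Qed.

(** The supremum is a true one because [f] is bounded on the compact cube. *)
Lemma modulus_ge (y z : 'rV[R]_d) (t : R) : cube d y -> cube d z ->
  `|y - z| <= t -> `|f y - f z| <= modulus_of_continuity f t.
Proof.
move=> yc zc yz; apply: ub_le_sup; last by exists y, z.
have [M HM] := continuous_cube_bounded.
exists (M + M) => _ [u [v [uc vc _ ->]]].
by rewrite (le_trans (ler_normB _ _)) // lerD // HM.
Qed.

Lemma modulus_ge0 (t : R) : 0 <= t -> 0 <= modulus_of_continuity f t.
Proof.
move=> t0; have c0 : cube d (0 : 'rV[R]_d) by move=> i; rewrite mxE lexx ler01.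
have := @modulus_ge 0 0 t c0 c0; rewrite !subrr !normr0; exact.
Qed.

End modulus.

(** * Volume of the closed and half-open unit cubes *)

Lemma subset_half_open_cube (R : realType) (d : nat) :
  half_open_cube d `<=` (cube d : set 'rV[R]_d).
Proof. by move=> x x01 i; have /andP[-> /ltW ->] := x01 i. Qed.

Lemma half_open_cubeE (R : realType) (d : nat) :
  half_open_cube d = box 0 (const_mx 1) :> set 'rV[R]_d.
Proof. by apply/seteqP; split => x x01 i; have := x01 i; rewrite !mxE. Qed.

Lemma measurable_half_open_cube (R : realType) (d : nat) :
  measurable (half_open_cube d : set 'rV[R]_d).
Proof. by rewrite half_open_cubeE; exact: measurable_box. Qed.

Lemma measurable_cube (R : realType) (d : nat) :
  measurable (cube d : set 'rV[R]_d).
Proof.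
apply: closed_measurable_rV; apply: compact_closed; last exact: cube_compact.
exact: norm_hausdorff.
Qed.

Lemma lebesgue_half_open_cube (R : realType) (d : nat) :
  lebesgue_rV d (half_open_cube d : set 'rV[R]_d) = 1%:E.
Proof.
rewrite half_open_cubeE lebesgue_rV_box => [|i]; last by rewrite !mxE.
by congr (_%:E); rewrite big1 // => i _; rewrite !mxE subr0.
Qed.

(** Each induction step adds [t (1 + t)^n <= 2^n t], which the doubling of the coefficient pays for;
    [expr_1B_ge] goes the same way. *)
Lemma expr_1D_le (R : realFieldType) (n : nat) (t : R) : 0 <= t <= 1 ->
  (1 + t) ^+ n <= 1 + 2 ^+ n * t.
Proof.
move=> /andP[t0 t1]; elim: n => [|n IHn]; first by rewrite !expr0 mul1r lerDl.
have t2 : (1 + t) ^+ n <= 2 ^+ n.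
  by rewrite lerXn2r ?nnegrE ?addr_ge0 // (_ : 2 = 1 + 1) // lerD2l.
rewrite !exprS mulrDl mul1r (_ : 2 * _ * t = 2 ^+ n * t + 2 ^+ n * t); last by ring.
by rewrite addrA lerD // mulrC ler_wpM2r.
Qed.

Lemma expr_1B_ge (R : realFieldType) (n : nat) (t : R) : 0 <= t <= 1 ->
  1 - 2 ^+ n * t <= (1 - t) ^+ n.
Proof.
move=> /andP[t0 t1]; elim: n => [|n IHn]; first by rewrite !expr0 mul1r lerBlDr lerDl.
have t2 : (1 - t) ^+ n <= 2 ^+ n.
  by rewrite lerXn2r ?nnegrE ?subr_ge0 //; lra.
rewrite !exprS mulrBl mul1r (_ : 2 * _ * t = 2 ^+ n * t + 2 ^+ n * t); last by ring.
by rewrite opprD addrA lerD // lerN2 mulrC ler_wpM2r.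
Qed.

Lemma lebesgue_cube_le1 (R : realType) (d : nat) :
  (lebesgue_rV d (cube d : set 'rV[R]_d) <= 1)%E.
Proof.
apply/lee_addgt0Pr => e e0.
(* The closed cube lies in the half-open box of side [1 + t], and this [t] makes
   [(1 + t)^d <= 1 + 2^d t <= 1 + e]. *)
pose t := Num.min 1 (e / 2 ^+ d).
have t0 : 0 < t by rewrite lt_min ltr01 divr_gt0 // exprn_gt0.
have sub : cube d `<=` (box 0 (const_mx (1 + t)) : set 'rV[R]_d).
  move=> x x01 i; rewrite !mxE; have /andP[-> x1] := x01 i.
  by rewrite /= (le_lt_trans x1) // ltrDl.
apply: (@le_trans _ _ (lebesgue_rV d (box 0 (const_mx (1 + t)) : set 'rV[R]_d))).
  apply: le_measure; rewrite ?inE //; first exact: measurable_cube.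
  exact: measurable_box.
rewrite lebesgue_rV_box => [|i]; last by rewrite !mxE addr_ge0 // ltW.
rewrite -EFinD lee_fin; under eq_bigr => i _ do rewrite !mxE subr0.
rewrite prodr_const card_ord; apply: (le_trans (expr_1D_le _ _)).
  by rewrite (ltW t0) ge_min lexx.
rewrite lerD2l mulrC -ler_pdivlMr ?exprn_gt0 //.
by rewrite ge_min lexx orbT.
Qed.

(** The polytope may touch the faces of the cube that the half-open cells do not reach; these carry
    no volume. *)
Lemma lebesgue_cube_diff (R : realType) (d : nat) :
  lebesgue_rV d (cube d `\` half_open_cube d : set 'rV[R]_d) = 0%E.
Proof.
have mC := @measurable_cube R d; have mH := @measurable_half_open_cube R d.
have C1 := @lebesgue_cube_le1 R d.
apply/eqP; rewrite eq_le measure_ge0 andbT.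
rewrite measureD //; last exact: le_lt_trans C1 (ltry _).
rewrite setIidr; last exact: subset_half_open_cube.
rewrite sube_le0 (_ : (_ (half_open_cube d) = 1%:E)%E) //.
exact: lebesgue_half_open_cube.
Qed.

(** * The error on the grid *)

Lemma normr_sum_le_card (R : numDomainType) (I : finType) (P : pred I) (g : I -> R)
    (c : R) :
  (forall i, P i -> `|g i| <= c) -> `|\sum_(i | P i) g i| <= c * #|P|%:R.
Proof.
move=> gc; apply: (le_trans (ler_norm_sum _ _ _)).
apply: (le_trans (ler_sum _ gc)).
by rewrite sumr_const mulr_natr.
Qed.

Lemma normr_Rintegral_le (d : measure_display) (T : measurableType d) (R : realType)
    (mu : {measure set T -> \bar R}) (B : set T) (g : T -> R) (c : R) :
  measurable B -> (mu B < +oo)%E -> mu.-integrable B (EFin \o g) ->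
  (forall y, B y -> `|g y| <= c) ->
  `|\int[mu]_(y in B) g y| <= c * fine (mu B).
Proof.
move=> mB Bfin gi gc; apply: (le_trans (le_normr_Rintegral mB gi)).
rewrite -Rintegral_cst //; apply: le_Rintegral => //.
- exact: integrable_norm.
- apply: (measurable_bounded_integrable mB) => //.
  exists `|c|; split; first exact: num_real.
  by move=> e /ltW ce y _.
Qed.

Section cell_error.
Context {R : realType} {d n : nat}.
Variables (x : 'I_n -> 'rV[R]_d) (f : 'rV[R]_d -> R) (A : set 'rV[R]_d) (M : R).
Hypothesis n0 : (0 < n)%N.
Hypothesis mA : measurable A.
Hypothesis f_cont : {within cube d, continuous f}.
Hypothesis fM : forall y, half_open_cube d y -> `|f y| <= M.

Notation mu := (lebesgue_rV d : {measure set 'rV[R]_d -> \bar R}).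

Lemma integrable_half_open_cube (B : set 'rV[R]_d) : measurable B ->
  B `<=` half_open_cube d -> mu.-integrable B (EFin \o f).
Proof.
move=> mB Bcube; apply: (@integrableS _ _ _ _ (half_open_cube d)) => //.
  exact: measurable_half_open_cube.
apply: measurable_bounded_integrable.
- exact: measurable_half_open_cube.
- have mu1 : mu (half_open_cube d) = 1%:E by exact: lebesgue_half_open_cube.
  by rewrite mu1 ltry.
- apply: (@measurable_funS _ _ _ _ (cube d)) => //.
  + exact: measurable_cube.
  + exact: subset_half_open_cube.
  + by apply: within_continuous_measurable_rV => //; exact: measurable_cube.
- exists M; split; first exact: num_real.
  by move=> c Mc y /= hy; exact: le_trans (fM hy) (ltW Mc).
Qed.

Let n0R : 0 < n%:R :> R. Proof. by rewrite ltr0n. Qed.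

Let count k (j : {ffun 'I_d -> 'I_k.+1}) : R :=
  n%:R^-1 * #|[pred i | x i \in grid_cell j]|%:R.

(** The three kinds of cells, inside [A], disjoint from [A] and on its boundary, are bounded
    separately; the conditional term is charged to boundary cells only. *)
Lemma cell_error k (j : {ffun 'I_d -> 'I_k.+1}) (t : R) : k.+1%:R^-1 <= t ->
  `| n%:R^-1 * (\sum_(i | (x i \in A) && (x i \in grid_cell j)) f (x i))
     - \int[lebesgue_rV d]_(y in A `&` grid_cell j) f y | <=
  modulus_of_continuity f t * (count j + k.+1%:R ^- d) +
  M * discrepancy x +
  (if `[< grid_cell j `&` A !=set0 /\ ~ (grid_cell j `<=` A) >]
   then 2 * M * k.+1%:R ^- d else 0).
Proof.
move=> ht; set rho := modulus_of_continuity f _; set v := k.+1%:R ^- d; set D := discrepancy x.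
have h0 : 0 <= k.+1%:R^-1 :> R by rewrite invr_ge0.
have rho0 : 0 <= rho by apply: modulus_ge0 => //; exact: le_trans ht.
have v0 : 0 <= v by rewrite invr_ge0 exprn_ge0.
have c0 : 0 <= count j by rewrite mulr_ge0.
have cD : `|count j - v| <= D by exact: discrepancy_grid_cell.
have D0 : 0 <= D by apply: le_trans cD.
(* The lower corner belongs to the half-open cell, so [M] bounds [f] there. *)
pose y0 : 'rV[R]_d := \row_i ((j i)%:R / k.+1%:R).
have jy0 : grid_cell j y0.
  by move=> i; rewrite !mxE lexx /= ltr_pM2r ?invr_gt0 // ltr_nat.
have M0 : 0 <= M by apply: le_trans (fM (grid_cell_half_open_cube jy0)).
have muj : mu (grid_cell j) = v%:E by exact: lebesgue_grid_cell.
have mj : measurable (grid_cell j : set 'rV[R]_d) by exact: measurable_grid_cell.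
have mAj : measurable (A `&` grid_cell j) by exact: measurableI.
have [jA|jA] := pselect (grid_cell j `<=` A).
  rewrite asboolF ?addr0; last by case.
  rewrite (setIidr jA).
  have -> : \sum_(i | (x i \in A) && (x i \in grid_cell j)) f (x i) =
      \sum_(i | x i \in grid_cell j) f (x i).
    apply: eq_bigl => i; case: (boolP (x i \in grid_cell j)); last by rewrite andbF.
    by move=> /set_mem /jA /mem_set ->.
  have fi := integrable_half_open_cube mj (@grid_cell_half_open_cube _ _ _ _).
  have ci : mu.-integrable (grid_cell j) (EFin \o cst (f y0)).
    apply: (measurable_bounded_integrable mj) => //.
    - by rewrite muj ltry.
    - exists `|f y0|; split; first exact: num_real.
      by move=> c /ltW yc y _.
  have sumE : \sum_(i | x i \in grid_cell j) f (x i) =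
      \sum_(i | x i \in grid_cell j) (f (x i) - f y0) +
      f y0 * #|[pred i | x i \in grid_cell j]|%:R.
    by rewrite sumrB sumr_const mulr_natr subrK.
  have intE : \int[mu]_(y in grid_cell j) f y =
      \int[mu]_(y in grid_cell j) (f y - f y0) + f y0 * v.
    rewrite (RintegralB mj fi ci) (Rintegral_cst mu mj) muj /= subrK //.
  have cubej y : grid_cell j y -> cube d y.
    by move=> /grid_cell_half_open_cube/subset_half_open_cube.
  have osc y : grid_cell j y -> `|f y - f y0| <= rho.
    move=> jy; apply: modulus_ge => //; try exact: cubej.
    exact: le_trans (grid_cell_dist jy jy0) ht.
  rewrite sumE intE.
  set S := \sum_(i | _) _; set I := \int[_]_(_ in _) _.
  have SD : `|n%:R^-1 * S| <= rho * count j.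
    rewrite normrM ger0_norm ?invr_ge0 ?ler0n // /count mulrCA ler_wpM2l ?invr_ge0 ?ler0n //.
    by apply: normr_sum_le_card => i /set_mem; exact: osc.
  have ID : `|I| <= rho * v.
    have -> : v = fine (mu (grid_cell j)) by rewrite muj.
    apply: normr_Rintegral_le => //; first by rewrite muj ltry.
    exact: (integrableB mj fi ci).
  have fD : `|f y0 * (count j - v)| <= M * D.
    by rewrite normrM ler_pM //; apply/fM/grid_cell_half_open_cube.
  (* The constant parts combine into [f y0 * (count j - v)], where the discrepancy enters; [S] and
     [I] hold the oscillation. *)
  have -> : n%:R^-1 * (S + f y0 * #|[pred i | x i \in grid_cell j]|%:R) - (I + f y0 * v) =
      n%:R^-1 * S - I + f y0 * (count j - v) by rewrite /count; ring.
  apply: (le_trans (ler_normD _ _)); apply: lerD => //.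
  by apply: (le_trans (ler_normB _ _)); rewrite mulrDr lerD.
have fi := integrable_half_open_cube mAj
  (subset_trans (@subIsetr _ _ _) (@grid_cell_half_open_cube _ _ _ _)).
have [jA0|jA0] := pselect (grid_cell j `&` A !=set0); last first.
  rewrite asboolF; last by case.
  have AE : A `&` grid_cell j = set0.
    by rewrite setIC; apply/eqP/negPn/negP => /set0P.
  rewrite AE Rintegral_set0 big_pred0 ?mulr0 ?subrr ?normr0 ?addr0; last first.
    move=> i; apply/negP => /andP[/set_mem xA /set_mem xj].
    by have : (A `&` grid_cell j) (x i) by []; rewrite AE.
  by rewrite addr_ge0 // mulr_ge0 // addr_ge0.
rewrite asboolT //.
(* [A] within the cell need not be a box, so all points of the cell are counted, a proportion of at
   most [D + v]. *)
have SD : `|n%:R^-1 * \sum_(i | (x i \in A) && (x i \in grid_cell j)) f (x i)| <= M * (D + v).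
  apply: (@le_trans _ _ (M * count j)); last first.
    rewrite ler_wpM2l // -lerBlDr; exact: le_trans (ler_norm _) cD.
  rewrite normrM ger0_norm ?invr_ge0 ?ler0n // /count mulrCA ler_wpM2l ?invr_ge0 ?ler0n //.
  apply: (@le_trans _ _ (M * #|[pred i | (x i \in A) && (x i \in grid_cell j)]|%:R)).
    apply: normr_sum_le_card => i /andP[_ /set_mem ji].
    exact/fM/(grid_cell_half_open_cube ji).
  rewrite ler_wpM2l // ler_nat; apply: subset_leq_card.
  by apply/fintype.subsetP => i /andP[].
have ID : `|\int[mu]_(y in A `&` grid_cell j) f y| <= M * v.
  have le_mu : (mu (A `&` grid_cell j) <= v%:E)%E.
    by rewrite -muj; apply: le_measure; rewrite ?inE.
  have Afin : (mu (A `&` grid_cell j) < +oo)%E by exact: le_lt_trans le_mu (ltry _).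
  apply: le_trans (normr_Rintegral_le mAj Afin fi _) _ => [y [_ jy]|].
    exact/fM/(grid_cell_half_open_cube jy).
  rewrite ler_wpM2l // -lee_fin fineK //.
  by rewrite ge0_fin_numE.
apply: (le_trans (ler_normB _ _)); apply: (le_trans (lerD SD ID)).
rewrite [leLHS](_ : _ = M * D + 2 * M * v); last by ring.
by rewrite lerD2r lerDr mulr_ge0 // addr_ge0.
Qed.

Hypothesis x01 : forall i, half_open_cube d (x i).
Hypothesis A_cube : A `<=` cube d.

Lemma sum_grid k (P : pred 'I_n) (g : 'I_n -> R) :
  \sum_(i | P i) g i = \sum_(j : {ffun 'I_d -> 'I_k.+1})
    \sum_(i | P i && (x i \in grid_cell j)) g i.
Proof.
rewrite (partition_big (fun i => grid_index k (x i)) xpredT) //=.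
apply: eq_bigr => j _; apply: eq_bigl => i; congr (_ && _).
by apply/eqP/idP => [/(grid_cellP _ (x01 i))/mem_set|/set_mem/(grid_cellP _ (x01 i))].
Qed.

Lemma integral_half_open_cube :
  \int[mu]_(y in A) f y = \int[mu]_(y in A `&` half_open_cube d) f y.
Proof.
have mC := @measurable_cube R d; have mH := @measurable_half_open_cube R d.
have Cfin : (mu (cube d) < +oo)%E.
  by apply: (@le_lt_trans _ _ 1%E); [exact: lebesgue_cube_le1|exact: ltry].
(* [M] bounds [f] on the half-open cube only; integrability on [A] calls for a bound on the closed
   cube. *)
have [K HK] := continuous_cube_bounded f_cont.
have fi : mu.-integrable A (EFin \o f).
  apply: (integrableS mC mA A_cube); apply: measurable_bounded_integrable => //.
    exact: within_continuous_measurable_rV.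
  exists K; split; first exact: num_real.
  by move=> c Kc y /= yc; exact: le_trans (HK _ yc) (ltW Kc).
rewrite /Rintegral (negligible_integral (measurableD mC mH) mA fi); last first.
  exact: lebesgue_cube_diff.
congr (fine (integral _ _ _)); apply/seteqP; split => y [Ay].
  by move=> H; split => //; apply: contrapT => H'; apply: H; split => //; exact: A_cube.
by move=> H; split => // -[].
Qed.

(** Sum of [cell_error] over the grid: proportions and volumes each total 1, whence the factor 2,
    and the discrepancy is paid once per cell. *)
Lemma grid_error k (t : R) : k.+1%:R^-1 <= t ->
  `| n%:R^-1 * (\sum_(i | x i \in A) f (x i)) - \int[mu]_(y in A) f y | <=
  2 * modulus_of_continuity f t + M * (k.+1%:R ^+ d * discrepancy x) +
  2 * M * \sum_(j : {ffun 'I_d -> 'I_k.+1} |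
    `[< grid_cell j `&` A !=set0 /\ ~ (grid_cell j `<=` A) >]) k.+1%:R ^- d.
Proof.
move=> ht; have mH := @measurable_half_open_cube R d.
have k0 : 0 < k.+1%:R :> R by rewrite ltr0n.
rewrite (sum_grid k) integral_half_open_cube.
have mAH : measurable (A `&` half_open_cube d) by exact: measurableI.
rewrite (integral_grid k mAH (@subIsetr _ _ _)); last first.
  exact: integrable_half_open_cube mAH (@subIsetr _ _ _).
rewrite mulr_sumr -sumrB; apply: (le_trans (ler_norm_sum _ _ _)).
have cardE : \sum_(j : {ffun 'I_d -> 'I_k.+1}) k.+1%:R ^- d = 1 :> R.
  by rewrite sumr_const card_grid -[LHS]mulr_natr natrX mulVf //.
have countE : \sum_(j : {ffun 'I_d -> 'I_k.+1}) count j = 1.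
  rewrite /count -mulr_sumr.
  under eq_bigr => j _ do rewrite -sumr_const.
  rewrite -(sum_grid k xpredT (fun=> 1)) sumr_const card_ord mulVf //.
  by rewrite gt_eqF.
apply: (@le_trans _ _ (\sum_(j : {ffun 'I_d -> 'I_k.+1})
  (modulus_of_continuity f t * (count j + k.+1%:R ^- d) + M * discrepancy x +
  (if `[< grid_cell j `&` A !=set0 /\ ~ (grid_cell j `<=` A) >]
   then 2 * M * k.+1%:R ^- d else 0)))).
  apply: ler_sum => j _.
  have -> : A `&` half_open_cube d `&` grid_cell j = A `&` grid_cell j.
    by rewrite -setIA [half_open_cube d `&` _]setIidr //; exact: grid_cell_half_open_cube.
  exact: cell_error.
rewrite !big_split /= -big_mkcond -!mulr_sumr big_split /= cardE countE.
have -> : \sum_(j : {ffun 'I_d -> 'I_k.+1}) discrepancy x =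
    k.+1%:R ^+ d * discrepancy x.
  by rewrite sumr_const card_grid -[LHS]mulr_natl natrX.
by rewrite [X in X + _ + _]mulrC.
Qed.

End cell_error.

(** * Signs of the geometric quantities *)

Lemma sup_ge0 (R : realType) (S : set R) : (forall r, S r -> 0 <= r) -> 0 <= sup S.
Proof.
(* By convention [sup] is 0 when there is no supremum. *)
move=> S0; have [sS|sS] := pselect (has_sup S); last by rewrite sup_out.
have [[r Sr] uS] := sS; exact: le_trans (S0 r Sr) (ub_le_sup uS Sr).
Qed.

Section nonnegativity.
Context {R : realType} {d : nat}.
Implicit Types A F : set 'rV[R]_d.

Lemma diam_ge0 A : 0 <= diam A.
Proof. by apply: sup_ge0 => _ [y [z [_ _ ->]]]. Qed.

Lemma surface_area_ge0 A : 0 <= surface_area A.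
Proof. by apply: fsumr_ge0 => F _; apply: fine_ge0; exact: measure_ge0. Qed.

Lemma inrad_ge A (x0 : 'rV[R]_d) (r : R) : (0 < d)%N -> A `<=` cube d ->
  0 <= r -> closed_ball_ Num.norm x0 r `<=` A -> r <= inrad A.
Proof.
move=> d0 Acube r0 rA; apply: ub_le_sup; last by split=> //; exists x0.
(* Radii are at most 1: [y] and [y + const_mx e] both lie in the cube, and some coordinate exists
   since [d > 0]. *)
exists 1 => e [e0 [y yA]]; pose i := Ordinal d0.
have /yA/Acube/(_ i)/andP[y0 _] : closed_ball_ Num.norm y e y.
  by rewrite /closed_ball_ /= subrr normr0.
have /yA/Acube/(_ i)/andP[_] : closed_ball_ Num.norm y e (y + const_mx e).
  rewrite /closed_ball_ /= opprD addrA subrr sub0r normrN.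
  by apply/rV_norm_le => // j; rewrite mxE ger0_norm.
by rewrite !mxE; apply: le_trans; rewrite lerDr.
Qed.

End nonnegativity.

(** * Choice of the threshold and of the mesh *)

Theorem theorem3p18 (R : realType) (d : nat) (d_ge1 : (1 <= d)%N)
    (f : 'rV[R]_d -> R) (f_cont : {within cube d, continuous f})
    (Delta : set 'rV[R]_d) (Delta_polytope : polytope Delta)
    (Delta_dim : has_dim Delta d) (Delta_cube : Delta `<=` cube d) :
  exists D0 : R, 0 < D0 /\
    forall (n : nat) (x : 'I_n -> 'rV[R]_d), (1 <= n)%N ->
      (forall i, half_open_cube d (x i)) ->
      let D := discrepancy x in
      D <= D0 ->
      forall M : R, (forall y, half_open_cube d y -> `|f y| <= M) ->
      `| n%:R^-1 * (\sum_(i < n | x i \in Delta) f (x i))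
         - \int[lebesgue_rV d]_(y in Delta) f y |
      <= (1 + 2 ^+ d.+1) * modulus_of_continuity f (D `^ (d.+1%:R^-1))
         + M * ((1 + 2 ^+ d.+1) * D `^ ((2 * d + 2)%:R^-1) / inrad Delta
                + (4 * d%:R * Num.sqrt d%:R + 1) * D `^ (d%:R^-1)
                  * (num_facets Delta)%:R
                + 2 * diam Delta * surface_area Delta
                  * D `^ ((2 * d + 2)%:R^-1) / Num.sqrt d%:R).
Proof.
have mDelta : measurable Delta.
  by apply: closed_measurable_rV; exact: polytope_closed.
have [x0 [r [r0 rDelta]]] := polytope_inball Delta_polytope Delta_dim.
have inr : 0 < inrad Delta.
  exact: lt_le_trans r0 (inrad_ge d_ge1 Delta_cube (ltW r0) rDelta).
have muDelta1 : (lebesgue_rV d Delta <= 1)%E.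
  apply: le_trans (lebesgue_cube_le1 R d); apply: le_measure; rewrite ?inE //.
  exact: measurable_cube.
have muDelta_fin : (lebesgue_rV d Delta < +oo)%E.
  exact: le_lt_trans muDelta1 (ltry _).
(* With [T = D^(1/(d+1))], the grid error apart from the modulus term will be at most [M * (T * C)]:
   the first summand is for the discrepancies of the cells, the second for the boundary cells, with
   a factor 2 to spare. *)
pose C : R := 2 ^+ d + 4 * 2 ^+ d.+1 / r.
have C0 : 0 < C by rewrite addr_gt0 ?divr_gt0 ?mulr_gt0 ?exprn_gt0.
pose c : R := (1 + 2 ^+ d.+1) / inrad Delta.
have c0 : 0 < c by rewrite divr_gt0 // addr_gt0 // exprn_gt0.
(* Bounds on [delta = D^(1/(2d+2))]: 1 gives [T <= 1], [r / 2] gives [T < r], and [c / C] gives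
   [T * C <= c * delta] since [T = delta^2]. The threshold [e^(2d+2)] says exactly [delta <= e]. *)
pose e : R := Num.min (Num.min 1 (r / 2)) (c / C).
have e0 : 0 < e by rewrite !lt_min ltr01 !divr_gt0.
exists (e ^+ (2 * d + 2)); split; first exact: exprn_gt0.
move=> n x n0 x01 D De M fM.
have D0 : 0 < D by exact: discrepancy_gt0.
pose delta := D `^ ((2 * d + 2)%:R^-1).
have delta0 : 0 < delta by exact: powR_gt0.
have delta_exp : delta ^+ (2 * d + 2) = D.
  by rewrite -powR_mulrn ?powR_ge0 // -powRrM mulVf ?powRr1 ?ltW // pnatr_eq0 addn2.
have delta_e : delta <= e.
  have N0 : (0 < 2 * d + 2)%N by rewrite addn2.
  by rewrite -(ler_pXn2r N0) ?nnegrE ?(ltW e0) ?(ltW delta0) // delta_exp.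
have [/andP[delta1 delta_r] delta_c] : (delta <= 1) && (delta <= r / 2) /\ delta <= c / C.
  by move: delta_e; rewrite !le_min => /andP[-> ->].
pose T := D `^ (d.+1%:R^-1).
have TE : T = delta ^+ 2.
  rewrite -powR_mulrn ?powR_ge0 // -powRrM; congr (_ `^ _).
  by rewrite -mulnSr natrM invfM mulrAC mulVf ?mul1r // pnatr_eq0.
have T0 : 0 < T by exact: powR_gt0.
have TD : T ^+ d.+1 = D by rewrite TE -exprM mulnSr.
have T_delta : T <= delta by rewrite TE expr2 ler_piMr // ltW.
have T1 : T <= 1 by exact: le_trans T_delta delta1.
have Tr : T < r.
  apply: (le_lt_trans T_delta); apply: (le_lt_trans delta_r).
  by rewrite ltr_pdivrMr // ltr_pMr // ltr1n.
(* The number of cells per axis satisfies [1/T < k+1 <= 2/T]: the side is below [T], yet [(k+1)^d *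
   D <= (2/T)^d * T^(d+1) = 2^d * T]. *)
pose k := Num.truncn T^-1.
have Ti0 : 0 <= T^-1 by rewrite invr_ge0 ltW.
have /andP[kT Tk] := truncn_itv Ti0.
have kpos : 0 < k.+1%:R :> R by rewrite ltr0n.
have hT : k.+1%:R^-1 <= T.
  by rewrite -[leRHS]invrK lef_pV2 ?posrE ?invr_gt0 // ltW.
have k2 : k.+1%:R <= 2 / T.
  rewrite -natr1 (_ : 2 / T = T^-1 + T^-1); last by field; rewrite gt_eqF.
  by rewrite lerD // invf_ge1.
have kD : k.+1%:R ^+ d * D <= 2 ^+ d * T.
  have : k.+1%:R ^+ d <= (2 / T) ^+ d.
    by rewrite lerXn2r ?nnegrE ?divr_ge0 // ltW.
  move/(ler_wpM2r (ltW D0)); move/le_trans; apply.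
  rewrite -[in leLHS]TD exprMn exprVn exprSr -mulrA mulKf //.
  by rewrite expf_neq0 // gt_eqF.
have M0 : 0 <= M.
  by apply: le_trans (fM 0 _) => // i; rewrite mxE lexx ltr01.
have := grid_error n0 mDelta f_cont fM x01 Delta_cube hT.
move/le_trans; apply.
have rho0 : 0 <= modulus_of_continuity f T by exact/modulus_ge0/ltW.
set rho := modulus_of_continuity f T in rho0 *.
(* The dilation parameter for which [s * r = T] dominates the side of a cell. *)
pose s := T / r.
have s0 : 0 < s by rewrite divr_gt0.
have s1 : s < 1 by rewrite ltr_pdivrMr // mul1r.
set S := \sum_(j | _) _.
have SC : S <= 2 * 2 ^+ d * s.
  have sr : k.+1%:R^-1 <= s * r by rewrite divfK // gt_eqF.
  have := @boundary_cells R d Delta x0 r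
    (fun y z t => @polytope_convex R d Delta y z t Delta_polytope)
    r0 rDelta mDelta muDelta_fin k s _ _ sr (fun j => @asboolW _).
  rewrite s0 s1 => /(_ isT) /le_trans; apply.
  have s01 : 0 <= s <= 1 by rewrite !ltW.
  have V0 : 0 <= fine (lebesgue_rV d Delta) by rewrite fine_ge0.
  have V1 : fine (lebesgue_rV d Delta) <= 1.
    by rewrite -lee_fin fineK // ge0_fin_numE.
  have H1 := expr_1D_le d s01; have H2 := expr_1B_ge d s01.
  have H3 : (1 - s) ^+ d <= (1 + s) ^+ d.
    by rewrite lerXn2r ?nnegrE ?subr_ge0 ?addr_ge0 ?ltW //; lra.
  (* [Delta] has volume at most 1, and each power differs from 1 by at most [2^d * s]. *)
  apply: (@le_trans _ _ ((1 + s) ^+ d - (1 - s) ^+ d)).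
    by rewrite ler_piMl // subr_ge0.
  lra.
have error_le : M * (k.+1%:R ^+ d * D) + 2 * M * S <= M * (c * delta).
  rewrite (_ : 2 * M * S = M * (2 * S)); last by ring.
  rewrite -mulrDr ler_wpM2l //.
  apply: (@le_trans _ _ (T * C)).
    rewrite (_ : T * C = 2 ^+ d * T + 2 * (2 * 2 ^+ d * s) + 2 * (2 * 2 ^+ d * s)).
      have : 0 <= 2 * 2 ^+ d * s by rewrite mulr_ge0 ?(ltW s0) // mulr_ge0 ?exprn_ge0.
      move: (2 * 2 ^+ d * s) SC => X SX X0.
      by rewrite -addrA lerD //; lra.
    by rewrite /C /s exprS; field; rewrite gt_eqF.
  rewrite TE expr2 -mulrA [leRHS]mulrC ler_wpM2l ?(ltW delta0) //.
  by rewrite -ler_pdivlMr.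
(* The coefficient 2 of the modulus is at most [1 + 2^(d+1)]. *)
rewrite -addrA; apply: lerD.
  have : 1 <= 2 ^+ d.+1 :> R by rewrite exprn_ege1 // ler1n.
  by move=> ?; rewrite ler_wpM2r //; lra.
apply: (le_trans error_le); rewrite ler_wpM2l //.
rewrite (_ : c * delta = (1 + 2 ^+ d.+1) * delta / inrad Delta); last first.
  by rewrite /c mulrAC.
rewrite -addrA lerDl addr_ge0 //.
  by rewrite !mulr_ge0 ?addr_ge0 ?mulr_ge0 ?sqrtr_ge0 ?powR_ge0 ?ler0n.
by rewrite !mulr_ge0 ?invr_ge0 ?sqrtr_ge0 ?diam_ge0 ?surface_area_ge0 ?powR_ge0.
Qed.
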